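(* Let $A,B$ be complex $d\times d$ matrices, let $m,n,s,t$ be real numbers such that $m+n=s+t=2$, and let $|||\cdot|||$ be an arbitrary unitarily invariant norm on the $d\times d$ complex matrices. Then $$\begin{aligned}|||AB^*|||^2\leq{}& |||p(A^*A)^{m}+ (1-p)(B^*B)^{s}|||^{\frac{1}{2}}\;|||(1-p)(A^*A)^{m}+ p(B^*B)^{s}|||^{\frac{1}{2}}\\ &\times|||p(A^*A)^{n}+ (1-p)(B^*B)^{t}|||^{\frac{1}{2}}\;|||(1-p)(A^*A)^{n}+p(B^*B)^{t}|||^{\frac{1}{2}},\end{aligned}$$ in which $p\in[0,1]$.
   Context: A norm $|||\cdot|||$ on the $d\times d$ complex matrices is unitarily invariant if $|||UAV|||=|||A|||$ for all matrices $A$ and all unitary matrices $U,V$. Powers of the positive semidefinite matrices $A^*A$ and $B^*B$ are understood in the sense of the functional calculus for Hermitian matrices. *)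

(* Defs.v *)
From mathcomp Require Import all_boot all_order all_algebra.
From mathcomp Require Import complex.
From mathcomp Require Import reals exp.

Set Implicit Arguments.
Unset Strict Implicit.
Unset Printing Implicit Defensive.

Import Order.TTheory GRing.Theory Num.Theory.

Local Open Scope ring_scope.
Local Open Scope complex_scope.
Local Open Scope sesquilinear_scope.

Record unitarily_invariant_norm (R : realType) (d : nat)
    (N : 'M[R[i]]_d -> R) : Prop := UnitarilyInvariantNorm {
  uin_triangle : forall X Y, N (X + Y) <= N X + N Y ;
  (* stated in R[i], where the modulus `|c| lives *)
  uin_homogeneous : forall (c : R[i]) X, (N (c *: X))%:C = `|c| * (N X)%:C ;
  uin_ge0 : forall X, 0 <= N X ;
  uin_definite : forall X, N X = 0 -> X = 0 ;
  uin_invariant : forall U V X, U \is unitarymx -> V \is unitarymx ->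
    N (U *m X *m V) = N X
}.

(* f(H) for Hermitian H. Spectral theorem: H is the product
   invmx (spectralmx H) *m diag_mx (spectral_diag H) *m spectralmx H,
   with spectralmx H unitary and real entries in spectral_diag H, so that
   taking real parts loses nothing. For other H the value is meaningless. *)
Definition hermitian_calculus (R : realType) (d : nat) (f : R -> R)
    (H : 'M[R[i]]_d) : 'M[R[i]]_d :=
  invmx (spectralmx H)
    *m diag_mx (map_mx (fun z : R[i] => (f (complex.Re z))%:C) (spectral_diag H))
    *m spectralmx H.

(* H^r for positive semidefinite H and real r. On the kernel of H the
   convention is that of powR: 0 `^ 0 = 1, and 0 `^ r = 0 for r != 0; thus for
   r < 0 and singular H the power is that of the Moore-Penrose inverse. *)
Definition psd_power (R : realType) (d : nat) (H : 'M[R[i]]_d) (r : R) :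
    'M[R[i]]_d :=
  hermitian_calculus (fun x => powR x r) H.

(* Main.v *)
Require Import Defs.
From mathcomp Require Import all_boot all_order all_fingroup all_algebra.
From mathcomp Require Import complex.
From mathcomp Require Import reals exp.
From mathcomp Require Import ring lra.
Import Order.TTheory GRing.Theory Num.Theory.
Local Open Scope ring_scope.
Local Open Scope sesquilinear_scope.

Set Implicit Arguments.
Unset Strict Implicit.

(** Write [^H] for the conjugate transpose. Any two square matrices [S], [T^H] can
    be triangularized simultaneously as [U S V^H] and [V T^H U^H] with [U], [V]
    unitary (the product Schur, or QZ, decomposition); the products of their
    diagonal entries are then the eigenvalues of [S T^H]. When these coincide with
    the squares of the singular values of [Z], pinching [U (p S + (1-p) T) V^H]
    and [U ((1-p) S + p T) V^H] to their diagonals yields entries whose products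
    dominate the squared singular values, so a diagonal Cauchy-Schwarz inequality
    gives [N Z ^+ 2 <= N (p S + (1-p) T) * N ((1-p) S + p T)].

    Let [X = A^H A], [Y = B^H B]. With [p = 1], [S = X^(m/2) Y^(s/2)] and
    [T = X^(n/2) Y^(t/2)] this bounds [N (A B^H) ^+ 2] by [N S * N T], since
    [A B^H (A B^H)^H] and [S T^H] both have the characteristic polynomial of
    [X Y]. Applied again to the pairs [X^m, Y^s] and [X^n, Y^t], it bounds
    [N S] and [N T]. *)

(** * Scalar inequality *)

Lemma normrM_convex_swap (C : numClosedFieldType) (p x y z : C) :
  0 <= p <= 1 -> x * y = `|z| ^+ 2 ->
  `|z| ^+ 2 <= `|p * x + (1 - p) * y^*| * `|(1 - p) * x + p * y^*|.
Proof.
move=> /andP[p0 p1] xy.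
have q0 : 0 <= 1 - p by rewrite subr_ge0.
have pR : p^* = p by rewrite geC0_conj.
have z2 : `|z| ^+ 2 = `|x| * `|y| by rewrite -normrM xy ger0_norm ?exprn_ge0.
rewrite -(norm_conjC (_ + p * _)) -normrM.
(* As [x * y] is real and nonnegative, the first factor times the conjugate of the second is itself
   a nonnegative real, exceeding [|z|^2] by a multiple of a square. *)
have -> : (p * x + (1 - p) * y^*) * ((1 - p) * x + p * y^*)^* =
   p * (1 - p) * (`|x| - `|y|) ^+ 2 + `|z| ^+ 2.
  rewrite !(rmorphD, rmorphN, rmorphM) /= conjCK rmorph1 pR.
  have -> : p * (1 - p) * (`|x| - `|y|) ^+ 2 + `|z| ^+ 2 =
    p * (1 - p) * (`|x| ^+ 2 + `|y| ^+ 2) + (p ^+ 2 + (1 - p) ^+ 2) * (x * y).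
    by rewrite [(x * y)]xy z2; ring.
  rewrite !normCK.
  have e : x^* * y^* = x * y by rewrite -rmorphM xy /= geC0_conj ?exprn_ge0.
  by ring: e.
have pq0 : 0 <= p * (1 - p) * (`|x| - `|y|) ^+ 2.
  apply: mulr_ge0; first exact: mulr_ge0.
  by rewrite real_exprn_even_ge0// realB// normr_real.
by rewrite ger0_norm ?lerDr ?addr_ge0 ?exprn_ge0.
Qed.

(** * Triangular forms and characteristic polynomials of products *)

Section ComplexMatrices.
Variable C : numClosedFieldType.

Lemma unitarymx_row0 n (v : 'rV[C]_n.+1) : v != 0 ->
  exists2 U : 'M[C]_n.+1, U \is unitarymx & exists c, row 0 U = c *: v.
Proof.
(* Gram-Schmidt runs on the matrix all of whose rows are [v]: row 0 of the result spans the line of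
   [v], the other rows just complete an orthonormal basis. *)
move=> v_neq0; pose A : 'M[C]_n.+1 := \matrix_(i, j) v 0 j.
exists (schmidt A); first exact: schmidt_unitarymx.
have := row_schmidt_sub A 0.
rewrite (big_pred1 0) => [|k]; last by rewrite leqn0.
have -> : row 0 A = v by apply/rowP => j; rewrite !mxE.
rewrite genmxE => /sub_rVP[c vE]; exists c^-1.
rewrite vE scalerA mulVf ?scale1r//.
by apply: contra_neq v_neq0 => c0; rewrite vE c0 scale0r.
Qed.

(** For invertible [S], an eigenvector [u] of [S *m T] pairs with [u *m S]. For singular [S], [u] is
    a kernel vector of [S], and [v] is its preimage under [T], or a kernel vector of [T] when [T] is
    singular too. *)
Lemma product_eigenvector n (S T : 'M[C]_n.+1) :
  exists u v : 'rV[C]_n.+1, [/\ u != 0, v != 0,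
    (u *m S <= v)%MS & (v *m T <= u)%MS].
Proof.
have kerP (M : 'M[C]_n.+1) : M \notin unitmx -> exists2 u : 'rV_n.+1, u != 0 & u *m M = 0.
  rewrite unitmxE unitfE negbK => /eqP/eqP/det0P[u u0 uM].
  by exists u.
have [Su|/kerP[u u0 uS]] := boolP (S \in unitmx).
  have [a /eigenvalueP[u uST u0]] := eigenvalue_closed (S *m T) (ltn0Sn n).
  exists u, (u *m S); split=> //; last by rewrite -mulmxA uST scalemx_sub.
  by apply: contra_neq u0 => uS; rewrite -(mulmxK Su u) uS mul0mx.
have [Tu|/kerP[v v0 vT]] := boolP (T \in unitmx); last first.
  by exists u, v; rewrite uS vT !sub0mx.
exists u, (u *m invmx T); rewrite uS sub0mx mulmxKV//; split=> //.
by apply: contra_neq u0 => uT; rewrite -(mulmxKV Tu u) uT mul0mx.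
Qed.

Lemma unitary_block1 n (U : 'M[C]_n) : U \is unitarymx ->
  (block_mx 1 0 0 U : 'M[C]_(1 + n)) \is unitarymx.
Proof.
move=> /unitarymxP UU; apply/unitarymxP.
rewrite tr_block_mx map_block_mx mulmx_block !trmx0 !map_mx0 !trmx1 !map_mx1.
by rewrite !(mulmx0, mul0mx, mul1mx, addr0, add0r) UU -scalar_mx_block.
Qed.

(** Deflation: unitaries whose first rows lie along the vectors of [product_eigenvector] clear the
    first row of both products to the right of the corner; the induction hypothesis handles the
    lower right blocks. *)
Lemma product_schur n (S T : 'M[C]_n) : exists U V : 'M[C]_n,
  [/\ U \is unitarymx, V \is unitarymx,
      is_trig_mx (U *m S *m V^t*) & is_trig_mx (V *m T *m U^t*)].
Proof.
elim: n S T => [|n IHn] S T.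
  exists 1%:M, 1%:M.
  have u1 : (1%:M : 'M[C]_0) \is unitarymx by apply/unitarymxP; apply/matrixP => -[].
  by split=> //; apply/is_trig_mxP => -[].
have [u [v [u0 v0 uSv vTu]]] := product_eigenvector S T.
have [U0 uU0 [a aU]] := unitarymx_row0 u0.
have [V0 uV0 [b bV]] := unitarymx_row0 v0.
have corner (M P Q : 'M[C]_(1 + n)) (x y : 'rV[C]_(1 + n)) a0 b0 :
    P \is unitarymx -> Q \is unitarymx -> row 0 P = a0 *: x -> row 0 Q = b0 *: y ->
    (x *m M <= y)%MS -> ursubmx (P *m M *m Q^t*) = 0.
  move=> uP uQ Px Qy /sub_rVP[c xMy].
  have b00 : b0 != 0.
    apply/eqP => b0z; have /unitarymxP/(congr1 (row 0)) := uQ.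
    rewrite row_mul Qy b0z scale0r mul0mx => /rowP/(_ 0).
    by rewrite !mxE eqxx => /eqP; rewrite eq_sym oner_eq0.
  have QQ : Q *m Q^t* = 1%:M by apply/unitarymxP.
  (* Row 0 of [P *m M] is a multiple of row 0 of [Q], and [Q] times its adjoint is the identity. *)
  have rE : row 0 (P *m M *m Q^t*) = (a0 * c / b0) *: row 0 (1%:M : 'M[C]_(1 + n)).
    rewrite !row_mul Px -scalemxAl xMy -QQ row_mul Qy -!scalemxAl !scalerA.
    by rewrite mulfVK.
  apply/matrixP => i j; rewrite ord1 2!mxE.
  move/rowP: rE => /(_ (rshift 1 j)).
  rewrite [LHS]mxE (_ : lshift n 0 = 0); last exact: val_inj.
  by rewrite [RHS]mxE => ->; rewrite !mxE /= mulr0.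
pose A : 'M[C]_(1 + n) := U0 *m S *m V0^t*.
pose B : 'M[C]_(1 + n) := V0 *m T *m U0^t*.
have A0 : ursubmx A = 0 by apply: (corner S U0 V0 u v a b).
have B0 : ursubmx B = 0 by apply: (corner T V0 U0 v u b a).
have [U1 [V1 [uU1 uV1 tS tT]]] := IHn (drsubmx A) (drsubmx B).
pose bl W : 'M[C]_(1 + n) := block_mx 1 0 0 W.
have blA (W W' : 'M[C]_n) (M : 'M[C]_(1 + n)) : ursubmx M = 0 ->
    is_trig_mx (W *m drsubmx M *m W'^t*) -> is_trig_mx (bl W *m M *m (bl W')^t*).
  move=> M0 tM; rewrite -[M]submxK M0 tr_block_mx map_block_mx !mulmx_block.
  rewrite !trmx0 !map_mx0 !trmx1 !map_mx1.
  rewrite !(mulmx0, mul0mx, mul1mx, mulmx1, addr0, add0r).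
  by rewrite is_trig_block_mx// eqxx mx11_is_trig.
exists (bl U1 *m U0), (bl V1 *m V0); split.
- by apply: mul_unitarymx => //; apply: unitary_block1.
- by apply: mul_unitarymx => //; apply: unitary_block1.
- by have := blA _ _ _ A0 tS; rewrite trmx_mul map_mxM !mulmxA.
- by have := blA _ _ _ B0 tT; rewrite trmx_mul map_mxM !mulmxA.
Qed.

Lemma char_poly_conj n (A U : 'M[C]_n) : U \in unitmx ->
  char_poly (U *m A *m invmx U) = char_poly A.
Proof.
move=> uU; pose P M : 'M_n := map_mx (@polyC C) M.
have PK : P U *m P (invmx U) = 1%:M by rewrite /P -map_mxM mulmxV// map_mx1.
have conjE : char_poly_mx (U *m A *m invmx U) = P U *m char_poly_mx A *m P (invmx U).
  by rewrite /char_poly_mx mulmxBr mulmxBl scalar_mxC -(mulmxA 'X%:M) PK mulmx1 !map_mxM.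
by rewrite /char_poly conjE !det_mulmx mulrAC -det_mulmx PK det1 mul1r.
Qed.

(** The adjoint of [V] cancels against [V] between the two triangular factors, so their product is a
    unitary conjugate of [S *m T]. *)
Lemma char_poly_product_schur n (S T U V : 'M[C]_n) :
  U \is unitarymx -> V \is unitarymx ->
  is_trig_mx (U *m S *m V^t*) -> is_trig_mx (V *m T *m U^t*) ->
  char_poly (S *m T) =
    \prod_i ('X - ((U *m S *m V^t*) i i * (V *m T *m U^t*) i i)%:P).
Proof.
move=> uU uV tS tT.
have -> : char_poly (S *m T) = char_poly (U *m S *m V^t* *m (V *m T *m U^t*)).
  rewrite !mulmxA mulmxKtV// -(mulmxA U) -(invmx_unitary uU).
  by rewrite char_poly_conj// unitarymx_unit.
have trigM (A B : 'M[C]_n) : is_trig_mx A -> is_trig_mx B ->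
    is_trig_mx (A *m B) /\ forall i, (A *m B) i i = A i i * B i i.
  move=> /is_trig_mxP tA /is_trig_mxP tB; split=> [|i].
    apply/is_trig_mxP => i j ij; rewrite mxE big1// => k _.
    have [ik|ki] := ltnP i k; first by rewrite tA ?mul0r.
    by rewrite tB ?mulr0//; apply: leq_ltn_trans ij.
  rewrite mxE (bigD1 i)//= big1 ?addr0// => k; rewrite neq_ltn => /orP[ki|ik].
    by rewrite tB ?mulr0.
  by rewrite tA ?mul0r.
have [tST dST] := trigM _ _ tS tT.
by rewrite char_poly_trig//; apply: eq_bigr => i _; rewrite dST.
Qed.

(** Exchanging the roles of [A] and [B] in the product Schur form only commutes the two factors of
    each root; this covers singular matrices. *)
Lemma char_polyMC n (A B : 'M[C]_n) : char_poly (A *m B) = char_poly (B *m A).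
Proof.
have [U [V [uU uV tA tB]]] := product_schur A B.
rewrite (char_poly_product_schur uU uV tA tB).
rewrite (char_poly_product_schur uV uU tB tA).
by apply: eq_bigr => i _; rewrite mulrC.
Qed.

(** In the product Schur form of [Z] and its adjoint, the second triangular matrix is the adjoint of
    the first, which is thus both lower and upper triangular. *)
Lemma singular_value_decomposition n (Z : 'M[C]_n) :
  exists U V (z : 'rV[C]_n), [/\ U \is unitarymx, V \is unitarymx,
    U *m Z *m V^t* = diag_mx z &
    char_poly (Z *m Z^t*) = \prod_i ('X - (`|z 0 i| ^+ 2)%:P)].
Proof.
have [U [V [uU uV tZ tZt]]] := product_schur Z (Z^t*).
have adjE : V *m Z^t* *m U^t* = (U *m Z *m V^t*)^t*.
  by rewrite !trmx_mul !map_mxM trmxCK mulmxA.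
exists U, V, (\row_i (U *m Z *m V^t*) i i); split=> //.
  apply/matrixP => i j; rewrite [RHS]mxE [in RHS]mxE.
  have [<-|] := eqVneq; first by rewrite mulr1n.
  rewrite neq_ltn mulr0n => /orP[ij|ji]; first by move/is_trig_mxP: tZ => ->.
  move/is_trig_mxP: tZt => /(_ _ _ ji); rewrite adjE 2!mxE => /eqP.
  by rewrite conjC_eq0 => /eqP.
rewrite (char_poly_product_schur uU uV tZ tZt) adjE.
by apply: eq_bigr => i _; rewrite normCK [in RHS]mxE [(_^t*) i i]mxE [_^T i i]mxE.
Qed.

Lemma unimodular_average (c : C) : `|c| <= 1 ->
  exists u v : C, [/\ `|u| = 1, `|v| = 1 & c = 2^-1 * (u + v)].
Proof.
move=> c1; set r := `|c|.
have [w w1 cE] : exists2 w : C, `|w| = 1 & c = r * w.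
  have [c0|c0] := eqVneq c 0.
    by exists 1; rewrite ?normr1// /r c0 normr0 mul0r.
  exists (c / r); first by rewrite normf_div normr_id divff ?normr_eq0.
  by rewrite mulrCA divff ?mulr1// normr_eq0.
have s0 : 0 <= 1 - r ^+ 2 by rewrite subr_ge0 exprn_ile1 ?normr_ge0.
set s := sqrtC (1 - r ^+ 2).
have rR : r \is Num.real by rewrite ger0_real ?normr_ge0.
have sR : s \is Num.real by rewrite ger0_real ?sqrtC_ge0.
have n1 (t : C) : t \is Num.real -> t ^+ 2 = 1 - r ^+ 2 -> `|(r + 'i * t) * w| = 1.
  move=> tR tE; rewrite normrM w1 mulr1; apply/eqP.
  by rewrite -(@eqrXn2 _ 2)// expr1n normC2_rect// tE addrC subrK.
(* The points [r + 'i * s] and [r - 'i * s] of the unit circle have midpoint [r]; both are rotated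
   by the phase [w] of [c]. *)
exists ((r + 'i * s) * w), ((r + 'i * (- s)) * w); split.
- by apply: n1 => //; rewrite sqrtCK.
- by apply: n1; rewrite ?rpredN// sqrrN sqrtCK.
- rewrite -mulrDl mulrN addrACA subrr addr0.
  by rewrite -mulr2n -(mulr_natl r) -mulrA mulKf ?pnatr_eq0.
Qed.

(** Equal characteristic polynomials have the same roots with multiplicity, whence the permutation
    [s]. One pair [U], [V] serves both [S] and [T], so the diagonals of their combinations are
    linear in [x] and [y]. *)
Lemma charpoly_diagonals n (S T Z : 'M[C]_n) :
  char_poly (Z *m Z^t*) = char_poly (S *m T^t*) ->
  exists (U V : 'M[C]_n) (x y : 'rV[C]_n), [/\ U \is unitarymx, V \is unitarymx,
    forall a b : C, \row_i (U *m (a *: S + b *: T) *m V) i i = a *: x + b *: y &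
    exists (U1 V1 : 'M[C]_n) (z : 'rV[C]_n) (s : 'S_n), [/\ U1 \is unitarymx,
      V1 \is unitarymx, U1 *m Z *m V1 = diag_mx z &
      forall i, x 0 i * (y 0 i)^* = `|z 0 (s i)| ^+ 2]].
Proof.
move=> eqST.
have [U1 [V1 [z [uU1 uV1 ZE chZ]]]] := singular_value_decomposition Z.
have [U [V [uU uV tS tT]]] := product_schur S (T^t*).
have chST := char_poly_product_schur uU uV tS tT.
have tE : V *m T^t* *m U^t* = (U *m T *m V^t*)^t*.
  by rewrite !trmx_mul !map_mxM trmxCK mulmxA.
exists U, (V^t*), (\row_i (U *m S *m V^t*) i i), (\row_i (U *m T *m V^t*) i i).
split; rewrite ?trmxC_unitary//.
  move=> a b; apply/rowP => i.
  by rewrite mulmxDr mulmxDl -!scalemxAr -!scalemxAl 3!mxE !(mxE, mulr_sumr).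
rewrite {}tE in chST.
pose t1 := [tuple (U *m S *m V^t*) i i * ((U *m T *m V^t*) i i)^* | i < n].
pose t2 := [tuple `|z 0 i| ^+ 2 | i < n].
have : perm_eq t1 t2.
  apply: prod_XsubC_eq; rewrite !big_tuple.
  under eq_bigr do rewrite tnth_mktuple.
  under [RHS]eq_bigr do rewrite tnth_mktuple.
  rewrite -chZ eqST chST; apply: eq_bigr => i _.
  by rewrite [(_^t*) i i]mxE [_^T i i]mxE.
move=> /tuple_permP[s ts]; exists U1, (V1^t*), z, s.
split; rewrite ?trmxC_unitary// => i; rewrite ![(\row__ _) 0 i]mxE.
by have := congr1 (fun t => tnth t i) (val_inj ts); rewrite !tnth_mktuple.
Qed.

(** * Spectral calculus *)

Definition spectral_calculus n (f : C -> C) (H : 'M[C]_n) : 'M[C]_n :=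
  invmx (spectralmx H) *m diag_mx (map_mx f (spectral_diag H)) *m spectralmx H.

Lemma spectral_calculusM n (f g : C -> C) (H : 'M[C]_n) :
  spectral_calculus f H *m spectral_calculus g H =
  spectral_calculus (fun z => f z * g z) H.
Proof.
rewrite /spectral_calculus !mulmxA mulmxK ?spectral_unit//.
rewrite -(mulmxA (invmx _) (diag_mx _) (diag_mx _)) mulmx_diag.
by congr (_ *m diag_mx _ *m _); apply/rowP => i; rewrite !mxE.
Qed.

Lemma spectral_calculus_adj n (f : C -> C) (H : 'M[C]_n) :
  (forall z, (f z)^* = f z) -> (spectral_calculus f H)^t* = spectral_calculus f H.
Proof.
move=> fR; rewrite /spectral_calculus invmx_unitary ?spectral_unitarymx//.
rewrite !trmx_mul !map_mxM trmxCK tr_diag_mx map_diag_mx mulmxA.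
by congr (_ *m diag_mx _ *m _); apply/rowP => i; rewrite !mxE; apply: fR.
Qed.

Lemma eq_spectral_calculus n (f g : C -> C) (H : 'M[C]_n) :
  f =1 g -> spectral_calculus f H = spectral_calculus g H.
Proof. by move=> fg; rewrite /spectral_calculus (eq_map_mx _ fg). Qed.

Lemma spectral_calculus_gram_id n (f : C -> C) (A : 'M[C]_n) :
  (forall z, 0 <= z -> f z = z) -> spectral_calculus f (A^t* *m A) = A^t* *m A.
Proof.
move=> fid; set H := A^t* *m A; have := erefl H; rewrite {2}/H.
move: H => H HA; have HH : H^t* = H by rewrite HA trmx_mul map_mxM /= trmxCK.
have HE : H = invmx (spectralmx H) *m diag_mx (spectral_diag H) *m spectralmx H.
  by apply/orthomx_spectralP; apply/normalmxP; rewrite HH.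
rewrite [RHS]HE /spectral_calculus; congr (_ *m diag_mx _ *m _).
apply/rowP => i; rewrite mxE; apply: fid.
move: (spectral_unitarymx H) HE.
move: (spectralmx H) (spectral_diag H) => P D uP; rewrite invmx_unitary// => HE.
(* In the eigenbasis the matrix of eigenvalues is again a Gram matrix, so each eigenvalue is a sum
   of squared moduli. *)
have DE : diag_mx D = (A *m P^t*)^t* *m (A *m P^t*).
  rewrite trmx_mul map_mxM /= trmxCK -mulmxA (mulmxA _ A) -HA HE.
  by rewrite -!mulmxA (unitarymxP uP) mulmx1 mulmxA (unitarymxP uP) mul1mx.
have -> : D 0 i = diag_mx D i i by rewrite mxE eqxx mulr1n.
rewrite DE mxE sumr_ge0// => k _; rewrite [(_^t*) _ _]mxE [_^T _ _]mxE.
by rewrite mulrC mul_conjC_ge0.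
Qed.

(** Cycling the factors turns both sides into the characteristic polynomial of the product of the
    two Gram matrices. *)
Lemma powers_charpoly n (A B Xa Xa' Yb Yb' : 'M[C]_n) :
  Xa^t* = Xa -> Xa'^t* = Xa' -> Yb^t* = Yb -> Yb'^t* = Yb' ->
  Xa' *m Xa = A^t* *m A -> Yb *m Yb' = B^t* *m B ->
  char_poly (A *m B^t* *m (A *m B^t*)^t*) =
  char_poly (Xa *m Yb *m (Xa' *m Yb')^t*).
Proof.
move=> hXa hXa' hYb hYb' XX YY; rewrite !trmx_mul !map_mxM trmxCK hXa' hYb'.
rewrite !mulmxA -(mulmxA Xa) YY char_polyMC [RHS]char_polyMC.
by rewrite !mulmxA XX.
Qed.

Lemma charpoly_hermitian_product n (P Q : 'M[C]_n) : P^t* = P -> Q^t* = Q ->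
  char_poly (P *m Q *m (P *m Q)^t*) = char_poly (P *m P *m (Q *m Q)).
Proof.
move=> hP hQ; rewrite trmx_mul map_mxM hP hQ.
by rewrite !mulmxA char_polyMC !mulmxA.
Qed.

End ComplexMatrices.

Lemma sqr_le_mul_of_amgm (R : realFieldType) (a b c : R) :
  0 <= a -> 0 <= b -> 0 <= c ->
  (forall t, 0 < t -> 2 * a <= t * b + t^-1 * c) -> a ^+ 2 <= b * c.
Proof.
rewrite [0 <= a]le_eqVlt => /predU1P[<- b0 c0 _|a0 b0 c0 H].
  by rewrite expr0n mulr_ge0.
move: b0; rewrite le_eqVlt => /predU1P[b0|b0].
  (* With [b = 0], this choice of [t] makes the right side smaller than [a], a contradiction. *)
  have := H ((c + 1) / a) (divr_gt0 (ltr_wpDl c0 ltr01) a0).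
  rewrite -b0 mulr0 add0r invf_div mulrAC ler_pdivlMr ?ltr_wpDl//.
  nra.
(* The choice [t = a / b] turns the bound into [a <= b * c / a] without any square root. *)
have := H (a / b) (divr_gt0 a0 b0).
rewrite divfK ?gt_eqF// invf_div mulrAC -lerBlDl ler_pdivlMr//.
nra.
Qed.

Local Open Scope complex_scope.
Local Open Scope sesquilinear_scope.

(** * Unitarily invariant norms *)

Section UnitarilyInvariant.
Variables (R : realType) (d : nat) (N : 'M[R[i]]_d -> R).
Hypothesis hN : unitarily_invariant_norm N.
Local Notation C := (R[i]).

Lemma uin_scale_real (a : R) X : 0 <= a -> N (a%:C *: X) = a * N X.
Proof.
move=> a0; have := uin_homogeneous hN a%:C X.
by rewrite ger0_norm ?lecR// -rmorphM => /complexI.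
Qed.

Lemma uin_average X Y : N (2^-1 *: (X + Y)) <= 2^-1 * (N X + N Y).
Proof.
have -> : 2^-1 = (2^-1 : R)%:C :> C by rewrite fmorphV rmorph_nat.
by rewrite uin_scale_real ?invr_ge0// ler_pM2l ?invr_gt0// uin_triangle.
Qed.

Lemma uin_average_le X Y Z : N Y = N X -> N Z = N X -> N (2^-1 *: (Y + Z)) <= N X.
Proof.
move=> YX ZX; have := uin_average Y Z.
by rewrite YX ZX -mulr2n -(mulr_natl (N X)) mulKf ?pnatr_eq0.
Qed.

Lemma diag_unitarymx (u : 'rV[C]_d) :
  (forall i, `|u 0 i| = 1) -> diag_mx u \is unitarymx.
Proof.
move=> u1; apply/unitarymxP; rewrite tr_diag_mx map_diag_mx mulmx_diag.
by apply/matrixP => i j; rewrite !mxE -normCK u1 expr1n.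
Qed.

Lemma uin_mull U X : U \is unitarymx -> N (U *m X) = N X.
Proof.
move=> uU; rewrite -[LHS](congr1 N (mulmx1 _)) uin_invariant//.
by apply/unitarymxP; rewrite trmx1 map_mx1 mulmx1.
Qed.

Lemma uin_diag_unimodular (u v : 'rV[C]_d) : (forall i, `|u 0 i| = 1) ->
  N (diag_mx (\row_i (u 0 i * v 0 i))) = N (diag_mx v).
Proof. by move=> u1; rewrite -mulmx_diag uin_mull// diag_unitarymx. Qed.

Lemma uin_diag_le (a b : 'rV[C]_d) :
  (forall i, `|a 0 i| <= `|b 0 i|) -> N (diag_mx a) <= N (diag_mx b).
Proof.
move=> ab; pose c i := a 0 i / b 0 i.
have c1 i : `|c i| <= 1.
  rewrite normf_div; have [->|b0] := eqVneq (b 0 i) 0.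
    by rewrite normr0 invr0 mulr0.
  by rewrite ler_pdivrMr ?normr_gt0// mul1r.
have acb i : a 0 i = c i * b 0 i.
  have [b0|b0] := eqVneq (b 0 i) 0; last by rewrite /c mulfVK.
  by have := ab i; rewrite b0 normr0 normr_le0 mulr0 => /eqP.
(* [diag_mx a] is [diag_mx b] times an average of two diagonal unitaries *)
have [u /fin_all_exists[v uv]] := fin_all_exists (fun i => unimodular_average (c1 i)).
pose w (f : 'I_d -> C) := \row_i f i.
have -> : diag_mx a = 2^-1 *: (diag_mx (\row_i (w u 0 i * b 0 i)) +
    diag_mx (\row_i (w v 0 i * b 0 i))).
  rewrite -linearD -linearZ; congr diag_mx; apply/rowP => i; rewrite !mxE acb.
  by have [_ _ ->] := uv i; rewrite -mulrDl mulrA.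
by apply: uin_average_le; apply: uin_diag_unimodular => i; rewrite mxE; have [] := uv i.
Qed.

Lemma uin_diag_norm (a : 'rV[C]_d) : N (diag_mx (\row_i `|a 0 i|)) = N (diag_mx a).
Proof. by apply/le_anti; rewrite !uin_diag_le// => i; rewrite mxE normr_id. Qed.

Lemma uin_diag_perm (s : 'S_d) (a : 'rV[C]_d) :
  N (diag_mx (\row_i a 0 (s i))) = N (diag_mx a).
Proof.
have uP (t : 'S_d) : (perm_mx t : 'M[C]_d) \is unitarymx.
  by apply/unitarymxP; rewrite tr_perm_mx map_perm_mx -perm_mxM mulgV perm_mx1.
have -> : diag_mx (\row_i a 0 (s i)) = perm_mx s *m diag_mx a *m perm_mx s^-1.
  rewrite -row_permE -[s^-1%g]/(s^-1)%g -col_permE.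
  by apply/matrixP => i j; rewrite !mxE (inj_eq perm_inj).
by rewrite uin_invariant.
Qed.

(** Conjugation by the reflection [D] flips the sign of exactly the off-diagonal entries in row and
    column [k], so averaging with [X] cancels them. *)
Lemma uin_decouple_le (X : 'M_d) (k : 'I_d) :
  N (\matrix_(i, j) if (i == k) == (j == k) then X i j else 0) <= N X.
Proof.
pose D : 'M[C]_d := diag_mx (\row_i if i == k then -1 else 1).
have uD : D \is unitarymx.
  by apply: diag_unitarymx => i; rewrite mxE; case: ifP; rewrite ?normrN normr1.
have -> : (\matrix_(i, j) if (i == k) == (j == k) then X i j else 0) =
    2^-1 *: (X + D *m X *m D).
  rewrite mul_mx_diag mul_diag_mx; apply/matrixP => i j; rewrite !mxE.
  case: (i == k); case: (j == k);
    rewrite /= ?(mulN1r, mulrN1, opprK, mul1r, mulr1, subrr, mulr0)//.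
    by rewrite -mulr2n -(mulr_natl (X i j)) mulKf ?pnatr_eq0.
  by rewrite -mulr2n -(mulr_natl (X i j)) mulKf ?pnatr_eq0.
by apply: uin_average_le; rewrite ?uin_invariant.
Qed.

Lemma uin_diagonal_le (X : 'M_d) : N (diag_mx (\row_i X i i)) <= N X.
Proof.
(* [P k] is [X] without the off-diagonal entries of its first [k] rows and columns; decoupling one
   index at a time leads from [X] at [k = 0] to the diagonal at [k = d]. *)
pose P k := \matrix_(i < d, j < d)
  if (i == j) || (k <= i)%N && (k <= j)%N then X i j else 0.
have PX k : (k <= d)%N -> N (P k) <= N X.
  elim: k => [_|k IHk kd].
    by rewrite (_ : P 0 = X)//; apply/matrixP => i j; rewrite mxE orbT.
  apply: le_trans (IHk (ltnW kd)).
  suff -> : P k.+1 = \matrix_(i, j)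
      if (i == Ordinal kd) == (j == Ordinal kd) then P k i j else 0.
    exact: uin_decouple_le.
  apply/matrixP => i j; rewrite !mxE -!val_eqE /=.
  case: (eqVneq (i : nat) j) => [->|ij] /=; first by rewrite eqxx.
  by case: ltngtP ij => [||->] ij; case: ltngtP => [||kj] //=; rewrite -?kj ?eqxx in ij.
suff -> : diag_mx (\row_i X i i) = P d by exact: PX.
apply/matrixP => i j; rewrite !mxE leqNgt ltn_ord orbF.
by case: eqVneq => [->|]; rewrite ?mulr1n.
Qed.

(** By AM-GM, [|z_i|] is at most [w_i = (t |x_i| + |y_i| / t) / 2] for every [t > 0]. Monotonicity
    on diagonals and the triangle inequality carry this over to norms, and a suitable [t] recovers
    the product. *)
Lemma uin_diag_cauchy_schwarz (x y z : 'rV[C]_d) :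
  (forall i, `|z 0 i| ^+ 2 <= `|x 0 i| * `|y 0 i|) ->
  N (diag_mx z) ^+ 2 <= N (diag_mx x) * N (diag_mx y).
Proof.
move=> zxy; apply: sqr_le_mul_of_amgm => [|||t t0]; rewrite ?(uin_ge0 hN)//.
pose w := \row_i (2^-1 * (t%:C * `|x 0 i| + (t^-1)%:C * `|y 0 i|)) : 'rV[C]_d.
have tC : 0 < t%:C by rewrite ltcR.
have VtC : (t^-1)%:C = t%:C^-1 by rewrite fmorphV.
have w0 i : 0 <= w 0 i.
  by rewrite mxE VtC mulr_ge0 ?addr_ge0 ?mulr_ge0 ?invr_ge0 ?ler0n// ltW.
have wz : N (diag_mx z) <= N (diag_mx w).
  apply: uin_diag_le => i; rewrite (ger0_norm (w0 i)) -ler_sqr ?nnegrE//.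
  apply: le_trans (zxy i) _; rewrite -subr_ge0 mxE VtC.
  have -> : (2^-1 * (t%:C * `|x 0 i| + t%:C^-1 * `|y 0 i|)) ^+ 2 - `|x 0 i| * `|y 0 i|
     = (2^-1 * (t%:C * `|x 0 i| - t%:C^-1 * `|y 0 i|)) ^+ 2.
    by field; rewrite gt_eqF.
  apply: real_exprn_even_ge0 => //.
  by rewrite realM ?realV ?realn// realB// realM ?normr_real ?realV// gtr0_real.
have -> : t * N (diag_mx x) + t^-1 * N (diag_mx y) =
    N (t%:C *: diag_mx (\row_i `|x 0 i|)) + N ((t^-1)%:C *: diag_mx (\row_i `|y 0 i|)).
  by rewrite !uin_scale_real ?invr_ge0 ?ltW// !uin_diag_norm.
rewrite -ler_pdivlMl//; apply: le_trans wz _; apply: le_trans (uin_average _ _).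
suff -> : diag_mx w = 2^-1 *: (t%:C *: diag_mx (\row_i `|x 0 i|) +
    (t^-1)%:C *: diag_mx (\row_i `|y 0 i|)) by [].
rewrite -!linearZ -linearD -linearZ; congr diag_mx.
by apply/rowP => i; rewrite !mxE.
Qed.

Lemma uin_convex_swap (S T Z : 'M[C]_d) (p : R) : 0 <= p <= 1 ->
  char_poly (Z *m Z^t*) = char_poly (S *m T^t*) ->
  N Z ^+ 2 <= N (p%:C *: S + (1 - p)%:C *: T) * N ((1 - p)%:C *: S + p%:C *: T).
Proof.
move=> p01 /charpoly_diagonals.
move=> [U [V [x [y [uU uV dE [U1 [V1 [z [s [uU1 uV1 ZE zxy]]]]]]]]]].
rewrite -(uin_invariant hN Z uU1 uV1) ZE -(uin_diag_perm s z).
have convE (a b : C) : N (diag_mx (a *: x + b *: y)) <= N (a *: S + b *: T).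
  rewrite -(uin_invariant hN (a *: S + b *: T) uU uV) -dE.
  exact: uin_diagonal_le.
apply: le_trans (ler_pM (uin_ge0 hN _) (uin_ge0 hN _) (convE _ _) (convE _ _)).
apply: uin_diag_cauchy_schwarz => i.
have pC : (0 : C) <= p%:C <= 1 by rewrite !lecR.
have qE : (1 - p)%:C = 1 - p%:C :> C by rewrite rmorphB rmorph1.
(* [zxy] pairs [x] with the conjugate of [y], which the scalar lemma conjugates back. *)
have := normrM_convex_swap pC (zxy i).
by rewrite conjCK qE !mxE.
Qed.

Lemma uin_charpoly_cauchy_schwarz (S T Z : 'M[C]_d) :
  char_poly (Z *m Z^t*) = char_poly (S *m T^t*) -> N Z ^+ 2 <= N S * N T.
Proof.
have p01 : 0 <= (1 : R) <= 1 by rewrite ler01 lexx.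
move=> /(uin_convex_swap p01).
by rewrite subrr !scale1r !scale0r addr0 add0r.
Qed.

(** This is the square root of [uin_convex_swap] for [Z = P *m Q], [S = X], [T = Y]: cycling
    [P *m Q *m Q *m P] gives the characteristic polynomial of [X *m Y]. *)
Lemma uin_hermitian_mul (P Q X Y : 'M[C]_d) (p : R) : 0 <= p <= 1 ->
  P^t* = P -> Q^t* = Q -> P *m P = X -> Q *m Q = Y ->
  N (P *m Q) <=
    Num.sqrt (N (p%:C *: X + (1 - p)%:C *: Y)) *
    Num.sqrt (N ((1 - p)%:C *: X + p%:C *: Y)).
Proof.
move=> p01 hP hQ <- <-.
have hQQ : (Q *m Q)^t* = Q *m Q by rewrite trmx_mul map_mxM hQ.
have eqPQ : char_poly (P *m Q *m (P *m Q)^t*) = char_poly (P *m P *m (Q *m Q)^t*).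
  by rewrite hQQ; exact: charpoly_hermitian_product.
move/ler_wsqrtr: (uin_convex_swap p01 eqPQ).
by rewrite sqrtr_sqr (ger0_norm (uin_ge0 hN _)) (sqrtrM _ (uin_ge0 hN _)).
Qed.

End UnitarilyInvariant.

(** * Real powers of matrices *)

Section PsdPower.
Variables (R : realType) (d : nat).
Local Notation C := (R[i]).

Let pow (r : R) (z : C) : C := (powR (complex.Re z) r)%:C.

Lemma psd_powerE (H : 'M[C]_d) r : psd_power H r = spectral_calculus (pow r) H.
Proof. by []. Qed.

Lemma psd_power_adj (H : 'M[C]_d) r : (psd_power H r)^t* = psd_power H r.
Proof. by apply: spectral_calculus_adj => z; exact: conjc_real. Qed.

Lemma psd_powerD (A : 'M[C]_d) (a b : R) : a + b = 1 ->
  psd_power (A^t* *m A) a *m psd_power (A^t* *m A) b = A^t* *m A.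
Proof.
move=> ab; rewrite !psd_powerE spectral_calculusM.
apply: spectral_calculus_gram_id => -[u v]; rewrite lecE /= => /andP[/eqP -> u0].
rewrite -rmorphM /=; suff -> : powR u a * powR u b = u by [].
(* [powR 0 0 = 1], but [a + b = 1] leaves at most one zero exponent *)
have [->|u1] := eqVneq u 0; last first.
  by rewrite -powRD ?u1 ?implybT// ab powRr1.
have [a0|a0] := eqVneq a 0; last by rewrite powR0// mul0r.
by rewrite [powR 0 b]powR0 ?mulr0//; move: ab; rewrite a0 add0r => ->; exact: oner_neq0.
Qed.

Lemma psd_power_half (H : 'M[C]_d) (a : R) :
  psd_power H (a / 2) *m psd_power H (a / 2) = psd_power H a.
Proof.
rewrite !psd_powerE spectral_calculusM; apply: eq_spectral_calculus => z.
rewrite /pow -rmorphM; congr (_%:C); set u := complex.Re z.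
(* At a zero eigenvalue, [a] and [a / 2] vanish together, so both sides are 1 if [a = 0] and 0
   otherwise. *)
have [->|u0] := eqVneq u 0.
  have [->|a0] := eqVneq a 0; first by rewrite mul0r powRr0 mulr1.
  by rewrite !powR0 ?mul0r// mulf_neq0 ?invr_eq0 ?pnatr_eq0.
by rewrite -powRD ?u0 ?implybT// -splitr.
Qed.

End PsdPower.

Unset Implicit Arguments.

Theorem corollary3p4 (R : realType) (d : nat) (A B : 'M[R[i]]_d)
    (m n s t p : R) (N : 'M[R[i]]_d -> R)
    (hmn : m + n = 2) (hst : s + t = 2)
    (hN : unitarily_invariant_norm N)
    (hp : 0 <= p <= 1) :
  N (A *m B^t*) ^+ 2 <=
    Num.sqrt (N (p%:C *: psd_power (A^t* *m A) m
           + (1 - p)%:C *: psd_power (B^t* *m B) s))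
  * Num.sqrt (N ((1 - p)%:C *: psd_power (A^t* *m A) m
           + p%:C *: psd_power (B^t* *m B) s))
  * Num.sqrt (N (p%:C *: psd_power (A^t* *m A) n
           + (1 - p)%:C *: psd_power (B^t* *m B) t))
  * Num.sqrt (N ((1 - p)%:C *: psd_power (A^t* *m A) n
           + p%:C *: psd_power (B^t* *m B) t)).
Proof.
pose Xh r := psd_power (A^t* *m A) (r / 2).
pose Yh r := psd_power (B^t* *m B) (r / 2).
have agm a b := uin_hermitian_mul hN hp
  (psd_power_adj _ (a / 2)) (psd_power_adj _ (b / 2))
  (psd_power_half (A^t* *m A) a) (psd_power_half (B^t* *m B) b).
have cs : N (A *m B^t*) ^+ 2 <= N (Xh m *m Yh s) * N (Xh n *m Yh t).
  apply: (uin_charpoly_cauchy_schwarz hN); apply: powers_charpoly.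
  - exact: psd_power_adj.
  - exact: psd_power_adj.
  - exact: psd_power_adj.
  - exact: psd_power_adj.
  (* Here [m + n = 2] and [s + t = 2] enter: the halved exponents add up to 1. *)
  - apply: psd_powerD; lra.
  - apply: psd_powerD; lra.
apply: (le_trans cs); rewrite -[leRHS]mulrA.
exact: (ler_pM (uin_ge0 hN _) (uin_ge0 hN _) (agm m s) (agm n t)).
Qed.
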